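(* Let $1<c<n$ be integers, write $n=cq+r$ with $0\le r<c$, and let $\gamma\le -1$. For every connected graph $G$ of order $n$ with clique number $c$, \[(c-r)\left\lfloor\tfrac{n}{c}\right\rfloor\left(n-\left\lfloor\tfrac{n}{c}\right\rfloor\right)^{\gamma}+r\left\lceil\tfrac{n}{c}\right\rceil\left(n-\left\lceil\tfrac{n}{c}\right\rceil\right)^{\gamma}\le {}^0R_{\gamma}(G)\le n-c+(n-1)^{\gamma}+(c-1)(c-1)^{\gamma}.\] The lower bound is attained if and only if $G=T_n(c)$, and the upper bound if and only if $G=PA_n(c)$.
   Context: ${}^0R_{\gamma}(G)=\sum_{u\in V(G)} d(u)^{\gamma}$. The Turán graph $T_n(c)$ is the complete $c$-partite graph of order $n$ whose partite sets differ in size by at most 1. The pineapple graph $PA_n(c)$ is obtained from $K_c$ by attaching $n-c$ pendant vertices to one vertex of $K_c$. The clique number is the maximum number of vertices of a complete subgraph. Graphs are finite and simple. *)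

(* Defs.v *)
From HB Require Import structures.
From mathcomp Require Import all_boot all_order all_algebra.
From mathcomp Require Import reals exp.

Set Implicit Arguments.
Unset Strict Implicit.
Unset Printing Implicit Defensive.

Import Order.TTheory GRing.Theory Num.Theory.

Record sgraph := SGraph {
  vertex :> finType;
  adj : rel vertex;
  adj_sym : symmetric adj;
  adj_irrefl : irreflexive adj }.

Definition connected_graph (G : sgraph) : Prop :=
  0 < #|G| /\ forall u v : G, connect (@adj G) u v.

Definition degree (G : sgraph) (u : G) : nat := #|[set v : G | adj u v]|.

Definition clique (G : sgraph) (K : {set G}) : bool :=
  [forall u in K, forall v in K, (u != v) ==> adj u v].

Definition clique_number (G : sgraph) : nat :=
  \max_(K : {set G} | clique K) #|K|.

Definition graph_iso (G H : sgraph) : Prop :=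
  exists2 f : G -> H, bijective f & forall u v : G, adj (f u) (f v) = adj u v.

(* The index ^0R_gamma; the power has a real exponent. *)
Definition zeroth_order_randic (R : realType) (gamma : R) (G : sgraph) : R :=
  (\sum_(u : G) (degree u)%:R `^ gamma)%R.

(* T_n(c): the partite sets are the residue classes modulo c in {0, ..., n-1};
   turan_part_balanced below shows that their sizes differ by at most 1. *)
Definition turan_adj (n c : nat) : rel 'I_n := fun i j => i %% c != j %% c.

Lemma turan_adj_sym n c : symmetric (@turan_adj n c).
Proof. by move=> i j; rewrite /turan_adj eq_sym. Qed.

Lemma turan_adj_irrefl n c : irreflexive (@turan_adj n c).
Proof. by move=> i; rewrite /turan_adj eqxx. Qed.

Definition turan_graph (n c : nat) : sgraph :=
  SGraph (@turan_adj_sym n c) (@turan_adj_irrefl n c).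

Definition turan_part (n c k : nat) : {set turan_graph n c} :=
  [set i : 'I_n | i %% c == k].

Lemma card_turan_part n c k :
  k < c -> #|turan_part n c k| = n %/ c + (k < n %% c).
Proof.
move=> ltkc; have c_gt0 : 0 < c by apply: leq_ltn_trans ltkc.
rewrite cardsE -sum1_card.
rewrite -(big_mkord (fun i => i %% c == k) (fun=> 1)).
elim: n => [|n IHn]; first by rewrite big_geq // div0n mod0n.
rewrite big_mkcond big_nat_recr //= -big_mkcond IHn.
have ltr := ltn_pmod n c_gt0.
have -> : n.+1 %/ c = n %/ c + (n %% c).+1 %/ c.
  by rewrite {1}(divn_eq n c) -addnS divnMDl.
have -> : n.+1 %% c = (n %% c).+1 %% c.
  by rewrite {1}(divn_eq n c) -addnS modnMDl.
rewrite -!addnA; congr (_ + _); move: (n %% c) ltr => r ltr.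
have [ltrc | lecr] := ltnP r.+1 c.
  by rewrite (divn_small ltrc) (modn_small ltrc) ltnS; case: ltngtP.
have rE : r.+1 = c by apply/eqP; rewrite eqn_leq ltr.
rewrite rE divnn c_gt0 modnn ltn0 addn0; move: ltkc; rewrite -rE ltnS.
by case: ltngtP.
Qed.

Lemma turan_part_balanced n c k l :
  k < c -> l < c -> #|turan_part n c k| <= #|turan_part n c l|.+1.
Proof.
move=> ltkc ltlc; rewrite !card_turan_part // -addnS leq_add2l.
by case: (_ < _).
Qed.

(* PA_n(c), for 0 < c <= n: the vertices below c form K_c, and each of the
   n - c remaining vertices is adjacent to the vertex 0 only. *)
Definition pineapple_adj (n c : nat) : rel 'I_n := fun i j =>
  (i != j) && [|| (i < c) && (j < c),
                  (i == 0 :> nat) && (c <= j) | (j == 0 :> nat) && (c <= i)].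

Lemma pineapple_adj_sym n c : symmetric (@pineapple_adj n c).
Proof.
move=> i j; rewrite /pineapple_adj eq_sym [(j < c) && _]andbC.
by congr (_ && (_ || _)); exact: orbC.
Qed.

Lemma pineapple_adj_irrefl n c : irreflexive (@pineapple_adj n c).
Proof. by move=> i; rewrite /pineapple_adj eqxx. Qed.

Definition pineapple_graph (n c : nat) : sgraph :=
  SGraph (@pineapple_adj_sym n c) (@pineapple_adj_irrefl n c).

(* Main.v *)
Require Import Defs.
From mathcomp Require Import all_boot all_order all_algebra.
From mathcomp Require Import reals exp.
From mathcomp Require Import ring lra zify.

Import Order.TTheory GRing.Theory Num.Theory.
Local Open Scope ring_scope.

(* Only two properties of f d = d ^ gamma are used: on positive integers it is
   strictly decreasing and strictly convex.

   Lower bound.  Let x_u = n - d(u) count the vertices not adjacent to u (u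
   included).  The sequence x f(n - x) is strictly convex, so its chord through
   q and q + 1 gives f(n - x) >= A + B / x with B < 0, with equality only for x
   in {q, q + 1}.  Summing over the vertices and inserting the Caro-Wei bound
   sum_u 1 / x_u <= c yields the lower bound.  Equality in Caro-Wei makes
   non-adjacency transitive, hence G complete multipartite, and the part sizes
   q, q + 1 then force the Turan graph.

   Upper bound.  Grow a vertex set S from a maximum clique, always adding a
   vertex v adjacent to some x in S.  In the induced subgraph v contributes at
   most f(1), while by convexity the term of x drops by at least
   f(|S| - 1) - f(|S|).  Equality means that v is pendant at a vertex x which
   dominates S, and this preserves the pineapple shape. *)

Set Implicit Arguments.
Unset Strict Implicit.
Unset Printing Implicit Defensive.

(** * Monotone and convex sequences *)

Lemma powR_nat_decr (R : realType) (gamma : R) (d e : nat) :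
  gamma < 0 -> (0 < d)%N -> (d < e)%N -> e%:R `^ gamma < d%:R `^ gamma.
Proof.
move=> g_lt0 d_gt0 lt_de; have e_gt0 : (0 < e)%N by apply: leq_trans lt_de.
rewrite -[gamma]opprK !(powRN _ (- gamma)).
rewrite ltf_pV2 ?posrE ?powR_gt0 ?ltr0n //.
by apply: gt0_ltr_powR; rewrite ?oppr_gt0 ?nnegrE ?ler0n ?ltr_nat.
Qed.

(* AM-GM bounds the sum of the outer terms below by twice the power of the
   geometric mean of d and d + 2, which is less than d + 1. *)
Lemma powR_nat_convex (R : realType) (gamma : R) (d : nat) :
  gamma < 0 -> (0 < d)%N ->
  d.+1%:R `^ gamma - d.+2%:R `^ gamma < d%:R `^ gamma - d.+1%:R `^ gamma.
Proof.
move=> g_lt0 d_gt0.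
have pos k : (0 < k)%N -> 0 < k%:R `^ gamma :> R.
  by move=> k0; rewrite powR_gt0 ?ltr0n.
have h : (d.+1%:R `^ gamma) ^+ 2 < d%:R `^ gamma * d.+2%:R `^ gamma :> R.
  rewrite expr2 -!powRM ?ler0n // -!natrM.
  by apply: powR_nat_decr => //; nia.
have := pos _ d_gt0; have := pos d.+1 isT; have := pos d.+2 isT.
move: (d%:R `^ gamma) (d.+1%:R `^ gamma) (d.+2%:R `^ gamma) h => a b e h e0 b0 a0.
rewrite ltNge; apply/negP => le_ab; have le_ab' : a + e <= b + b by lra.
have : (a + e) * (a + e) <= (b + b) * (b + b) by rewrite ler_pM //; lra.
by have := sqr_ge0 (a - e); nra.
Qed.

Lemma convex_slope (R : realDomainType) (g : nat -> R) (m i j : nat) :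
  (forall k, (k.+1 < m)%N -> g k.+1 - g k < g k.+2 - g k.+1) ->
  (i < j)%N -> (j < m)%N -> g i.+1 - g i < g j.+1 - g j.
Proof.
move=> conv; elim: j => // j IHj lt_ij lt_jm.
have h := conv _ lt_jm.
move: lt_ij; rewrite ltnS leq_eqVlt => /predU1P[-> //|lt_ij].
exact: lt_trans (IHj lt_ij (ltnW lt_jm)) h.
Qed.

(** Every increment past [q.+1] exceeds the slope of the chord and every increment before [q] is
    smaller, so by induction on the distance the sequence lies strictly above the line on both
    sides. *)
Lemma convex_chord (R : realDomainType) (g : nat -> R) (m q x : nat) :
  (forall k, (k.+1 < m)%N -> g k.+1 - g k < g k.+2 - g k.+1) ->
  (q < m)%N -> (x <= m)%N ->
  g q + (g q.+1 - g q) * (x%:R - q%:R) <= g x ?= iff (x == q) || (x == q.+1).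
Proof.
move=> conv lt_qm le_xm.
have slope i j : (i < j)%N -> (j < m)%N -> g i.+1 - g i < g j.+1 - g j.
  exact: convex_slope.
have above k : (q.+1 + k.+1 <= m)%N ->
  g q + (g q.+1 - g q) * k.+2%:R < g (q.+1 + k.+1)%N.
  elim: k => [|k IHk] le_km.
    rewrite addn1 in le_km *.
    by have := slope q q.+1 (ltnSn q) le_km; lra.
  have lt_km : (q.+1 + k.+1 < m)%N by lia.
  have := slope q _ (leq_addr _ q.+1) lt_km; have := IHk (ltnW lt_km).
  by rewrite -[k.+3%:R]natr1 -addnS; lra.
have below k : (k < q)%N ->
  g q + (g q.+1 - g q) * (- k.+1%:R) < g (q - k.+1)%N.
  (* [rev_ord_proof] only supplies that the new point lies below [q], so that its increment can be
     compared with the one at [q]. *)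
  elim: k => [|k IHk] lt_kq; have /slope/(_ lt_qm) := rev_ord_proof (Ordinal lt_kq).
    by rewrite -subSn // subSS subn0; lra.
  rewrite /= -subSn // subSS; have := IHk (ltnW lt_kq).
  by rewrite -[k.+2%:R]natr1; lra.
have [lt_xq|lt_qx|->] := ltngtP x q.
- apply/leifP; rewrite ifF; last by apply/negbTE; lia.
  have /below : ((q - x).-1 < q)%N by lia.
  have -> : (q - x).-1.+1 = (q - x)%N by lia.
  by rewrite natrB 1?ltnW // subKn 1?ltnW // opprB.
- have [->|nx] := eqVneq x q.+1.
    by apply/leifP; rewrite /= -natr1; apply/eqP; ring.
  apply/leifP; rewrite /=.
  have -> : x = (q.+1 + (x - q.+2).+1)%N by lia.
  have /above : (q.+1 + (x - q.+2).+1 <= m)%N by lia.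
  move: (x - q.+2)%N => k; congr (_ + _ * _ < _).
  by rewrite addSnnS natrD addrAC subrr add0r.
- by apply/leifP; rewrite /= subrr mulr0 addr0 eqxx.
Qed.

(** * The Caro-Wei bound with its equality case *)

(** A vertex [u] of [S] belongs to its own set, so the cardinal is positive and can be inverted. *)
Definition non_neighbours (G : sgraph) (S : {set G}) (u : G) : {set G} :=
  [set v in S | ~~ adj u v].

Lemma cliqueU1 (G : sgraph) (v : G) (K : {set G}) :
  clique K -> {in K, forall u, adj v u} -> clique (v |: K).
Proof.
move=> /forall_inP cK avK; apply/forall_inP => x xK; apply/forall_inP => y yK.
apply/implyP => nxy; move: xK yK.
rewrite !inE => /predU1P[xv|xK] /predU1P[yv|yK].
- by rewrite xv yv eqxx in nxy.
- by rewrite xv avK.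
- by rewrite yv adj_sym avK.
- by move/forall_inP: (cK x xK) => /(_ y yK); rewrite nxy.
Qed.

Lemma non_neighboursS (G : sgraph) (S T : {set G}) (u : G) :
  T \subset S -> non_neighbours T u \subset non_neighbours S u.
Proof.
by move=> TS; apply/subsetP => w; rewrite !inE => /andP[/(subsetP TS)-> ->].
Qed.

Lemma non_neighbours_gt0 (G : sgraph) (S : {set G}) (u : G) :
  u \in S -> (0 < #|non_neighbours S u|)%N.
Proof. by move=> uS; apply/card_gt0P; exists u; rewrite !inE uS adj_irrefl. Qed.

Lemma leif_natV (R : realFieldType) (k l : nat) :
  (0 < k)%N -> (k <= l)%N -> (l%:R^-1 : R) <= k%:R^-1 ?= iff (k == l).
Proof.
move=> k_gt0 le_kl; have l_gt0 := leq_trans k_gt0 le_kl; split.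
  by rewrite lef_pV2 ?posrE ?ltr0n // ler_nat.
by rewrite (inj_eq invr_inj) eqr_nat eq_sym.
Qed.

(* Greedy choice: a vertex v of S with the fewest non-neighbours contributes,
   together with these, at most 1 to the sum. *)
Lemma caro_wei (R : realFieldType) (G : sgraph) (S : {set G}) :
  exists K : {set G}, [/\ clique K, K \subset S,
    \sum_(u in S) #|non_neighbours S u|%:R^-1 <= #|K|%:R :> R &
    \sum_(u in S) #|non_neighbours S u|%:R^-1 = #|K|%:R :> R ->
    {in S & &, forall u v w, ~~ adj u v -> ~~ adj v w -> ~~ adj u w}].
Proof.
have [m] := ubnP #|S|; elim: m S => // m IHm S /ltnSE le_Sm.
have [->|[v0 v0S]] := set_0Vmem S.
  exists set0; rewrite sub0set big_set0 cards0 lexx.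
  by split=> // [|_ u v w]; [apply/forall_inP => u|]; rewrite inE.
pose v := [arg min_(v < v0 in S) #|non_neighbours S v|].
have [vS v_min] : v \in S /\ {in S, forall u,
    (#|non_neighbours S v| <= #|non_neighbours S u|)%N}.
  by rewrite /v; case: arg_minnP.
pose N := non_neighbours S v; pose T := S :\: N.
have sNS : N \subset S by apply/subsetP => u; rewrite inE => /andP[].
have sTS : T \subset S by apply: subsetDl.
have vN : v \in N by rewrite !inE vS adj_irrefl.
have avT u : u \in T -> adj v u.
  by rewrite !inE => /andP[+ uS]; rewrite uS negbK.
have [|K [cK sKT leK trK]] := IHm T.
  apply: leq_trans le_Sm; apply/proper_card/properP; split=> //.
  by exists v; rewrite // inE vN.
have vK : v \notin K by apply/negP => /(subsetP sKT)/avT; rewrite adj_irrefl.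
exists (v |: K); rewrite cardsU1 vK add1n -natr1.
(* By minimality of [v], each of the [#|N|] vertices of [N] contributes at most [1 / #|N|]; the
   total is paid for by the one vertex [v] added to the clique. *)
have leN : \sum_(u in N) #|non_neighbours S u|%:R^-1 <=
    \sum_(u in N) #|N|%:R^-1 ?= iff
    [forall (u | u \in N), #|N| == #|non_neighbours S u|] :> R.
  apply: leif_sum => u uN; apply: leif_natV; first by apply/card_gt0P; exists v.
  exact/v_min/(subsetP sNS).
(* Non-neighbour sets shrink from [S] to [T], so the inverses can only grow. *)
have leT : \sum_(u in T) #|non_neighbours S u|%:R^-1 <=
    \sum_(u in T) #|non_neighbours T u|%:R^-1 ?= iff
    [forall (u | u \in T), #|non_neighbours T u| == #|non_neighbours S u|] :> R.
  apply: leif_sum => u uT; apply: leif_natV; first exact: non_neighbours_gt0.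
  exact/subset_leq_card/non_neighboursS.
have sumN : \sum_(u in N) #|N|%:R^-1 = 1 :> R.
  rewrite sumr_const -[LHS]mulr_natr mulVf // pnatr_eq0 -lt0n.
  by apply/card_gt0P; exists v.
rewrite (big_setID N) (setIidPr sNS) /=; rewrite sumN in leN.
have [leN1 eqN] := leN; have [leT1 eqT] := leT.
split; first by apply: cliqueU1 => // u /(subsetP sKT)/avT.
- by rewrite subUset sub1set vS (subset_trans sKT).
- lra.
move=> eqS.
have {eqN} /forall_inP eqN : [forall (u | u \in N), #|N| == #|non_neighbours S u|].
  by rewrite -eqN; apply/eqP; lra.
have {eqT} /forall_inP eqT : [forall (u | u \in T),
    #|non_neighbours T u| == #|non_neighbours S u|].
  by rewrite -eqT; apply/eqP; lra.
have {trK} trT := trK ltac:(lra).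
(* Equality gives a vertex of [T] as many non-neighbours in [T] as in [S]; hence none lies in
   [N]. *)
have aTN u w : u \in T -> w \in N -> adj u w.
  move=> uT wN; apply: contraTT uT => auw; apply/negP => uT.
  have /eqP eqx := eqT u uT.
  have : non_neighbours T u == non_neighbours S u.
    by rewrite eqEcard non_neighboursS //= eqx.
  move/eqP/setP/(_ w); rewrite !inE auw andbT.
  by move: (wN); rewrite !inE => /andP[-> ->].
(* [u] has exactly [#|N|] non-neighbours and, [N] and [T] being completely joined, all of them lie
   in [N]; so they fill [N]. *)
have iN u w : u \in N -> w \in N -> ~~ adj u w.
  move=> uN wN; have /eqP eqx := eqN u uN.
  have : non_neighbours S u == N.
    rewrite eqEcard eqx leqnn andbT; apply/subsetP => x.
    rewrite !inE => /andP[xS aux]; rewrite xS /=.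
    apply: contra aux => avx; have xT : x \in T by rewrite !inE xS avx.
    by rewrite adj_sym aTN.
  by move/eqP => eqNu; move: wN; rewrite -eqNu !inE => /andP[].
have NT u : u \in S -> (u \in N) || (u \in T).
  by move=> uS; rewrite in_setD uS andbT orbN.
(* Non-adjacency never crosses between [N] and [T], so only triples inside one of them remain. *)
move=> x y z xS yS zS axy ayz.
have [xN|xT] := orP (NT x xS).
  have [yN|yT] := orP (NT y yS); last by rewrite adj_sym aTN in axy.
  have [zN|zT] := orP (NT z zS); last by rewrite adj_sym aTN in ayz.
  exact: iN.
have [yN|yT] := orP (NT y yS); first by rewrite aTN in axy.
have [zN|zT] := orP (NT z zS); first by rewrite aTN in ayz.
exact: trT ayz.
Qed.

(** * The lower bound *)

Lemma card_non_neighbours (G : sgraph) (u : G) :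
  #|non_neighbours [set: G] u| = (#|G| - degree u)%N.
Proof.
rewrite cardsCs; congr (_ - _)%N.
by apply: eq_card => v; rewrite !inE negbK.
Qed.

Lemma connected_degree_gt0 (G : sgraph) (u : G) :
  connected_graph G -> (1 < #|G|)%N -> (0 < degree u)%N.
Proof.
move=> [_ conn] /card_gt1P[x [y [_ _ nxy]]].
have [v nvu] : exists v, v != u.
  by have [<-|] := eqVneq x u; [exists y; rewrite eq_sym | exists x].
have /connectP[[|w p] /= pth def_v] := conn u v.
  by rewrite def_v eqxx in nvu.
by apply/card_gt0P; exists w; rewrite inE; case/andP: pth.
Qed.

Lemma degree_lt (G : sgraph) (u : G) : (degree u < #|G|)%N.
Proof.
rewrite -cardsT; apply/proper_card/properP; split; first exact: subsetT.
by exists u; rewrite !inE // adj_irrefl.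
Qed.

Lemma clique_number_ge (G : sgraph) (K : {set G}) :
  clique K -> (#|K| <= clique_number G)%N.
Proof. by move=> cK; apply: (leq_bigmax_cond (F := fun K : {set G} => #|K|)). Qed.

(* The chord through q and q + 1 of the convex sequence x f (n - x), divided
   by x, bounds f (n - x) below by an affine function of 1 / x. *)
Lemma degree_sum_lower (R : realFieldType) (f : nat -> R) (n c q r : nat)
    (G : sgraph) :
  (forall d e, (0 < d)%N -> (d < e)%N -> f e < f d) ->
  (forall d, (0 < d)%N -> f d.+1 - f d.+2 < f d - f d.+1) ->
  (1 < c)%N -> (c < n)%N -> n = (c * q + r)%N -> (r < c)%N ->
  connected_graph G -> #|G| = n -> (clique_number G <= c)%N ->
  let lower :=
    (c%:R - r%:R) * q%:R * f (n - q)%N + r%:R * q.+1%:R * f (n - q.+1)%N in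
  lower <= \sum_(u : G) f (degree u) /\
  (\sum_(u : G) f (degree u) = lower ->
   [/\ forall u v w : G, ~~ adj u v -> ~~ adj v w -> ~~ adj u w,
       forall u : G, (#|non_neighbours [set: G] u| == q)
                  || (#|non_neighbours [set: G] u| == q.+1)
     & \sum_(u : G) #|non_neighbours [set: G] u|%:R^-1 = c%:R :> R]).
Proof.
move=> f_decr f_conv c_gt1 lt_cn n_eq lt_rc conn cardG le_cl lower.
have q_gt0 : (0 < q)%N by case: (q) n_eq => //; lia.
have lt_qn : (q.+1 < n)%N by nia.
pose g x := x%:R * f (n - x)%N.
(* With [d = n - k.+2], the second difference of [g] is [k] times that of [f] at [d], plus
   [2 * (f d - f d.+1)]. The range stops at [n.-1] to keep [d] positive. *)
have g_conv k : (k.+1 < n.-1)%N -> g k.+1 - g k < g k.+2 - g k.+1.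
  move=> lt_kn; rewrite /g.
  have -> : (n - k = (n - k.+2).+2)%N by lia.
  have -> : (n - k.+1 = (n - k.+2).+1)%N by lia.
  have d_gt0 : (0 < n - k.+2)%N by lia.
  have := f_conv _ d_gt0; have := f_decr _ _ d_gt0 (ltnSn _).
  have := f_decr _ _ (ltn0Sn (n - k.+2)) (ltnSn _).
  move: (n - k.+2)%N => d; have := ler0n R k.
  rewrite -![_.+2%:R]natr1 -![_.+1%:R]natr1.
  by move: (f d) (f d.+1) (f d.+2) (k%:R) => a b e x; nra.
pose x (u : G) := #|non_neighbours [set: G] u|.
have xE u : x u = (n - degree u)%N by rewrite /x card_non_neighbours cardG.
have x_gt0 u : (0 < x u)%N by rewrite xE subn_gt0 -cardG degree_lt.
(* No vertex is isolated, so [x u] stays in the range where [g] is convex. *)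
have x_lt u : (x u <= n.-1)%N.
  by rewrite xE; have := @connected_degree_gt0 G u conn; rewrite cardG; lia.
have degE u : degree u = (n - x u)%N.
  by rewrite xE subKn // -cardG ltnW // degree_lt.
(* The chord of [g] through [q] and [q.+1] has slope [A] and value [B] at 0. *)
pose A := g q.+1 - g q; pose B := g q - q%:R * A.
(* Expanding, [B = q * (q + 1) * (f (n - q) - f (n - q.+1))]. *)
have B_lt0 : B < 0.
  rewrite /B /A /g; have := f_decr (n - q.+1)%N (n - q)%N.
  rewrite -natr1 => h.
  have {h} : f (n - q)%N < f (n - q.+1)%N by apply: h; lia.
  have : 1 <= q%:R :> R by rewrite ler1n.
  by move: (f _) (f _) (q%:R) => a b y; nra.
have term u : A + B * (x u)%:R^-1 <= f (degree u)
    ?= iff (x u == q) || (x u == q.+1) :> R.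
  have x0 : 0 < (x u)%:R :> R by rewrite ltr0n.
  have -> : A + B * (x u)%:R^-1 = (g q + A * ((x u)%:R - q%:R)) * (x u)%:R^-1.
    by rewrite /B; field; rewrite gt_eqF.
  have -> : f (degree u) = g (x u) * (x u)%:R^-1.
    by rewrite degE /g mulrAC divff ?mul1r // gt_eqF.
  rewrite (mono_leif (ler_pM2r _)) ?invr_gt0 //.
  by apply: convex_chord g_conv _ (x_lt u); lia.
have := leif_sum (P := predT) (fun u _ => term u).
rewrite big_split /= sumr_const -mulr_sumr cardG.
have [K [cK _ leK trK]] := caro_wei R [set: G].
have sumT (F : G -> R) : \sum_(u in [set: G]) F u = \sum_(u : G) F u.
  by apply: eq_bigl => u; rewrite inE.
rewrite sumT in leK trK.
have {}le_cl : #|K|%:R <= c%:R :> R.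
  by rewrite ler_nat (leq_trans (clique_number_ge cK)).
(* As [n = c * q + r], the right side is [c * g q + r * A = (c - r) * g q + r * g q.+1]. *)
have lowerE : lower = A *+ n + B * c%:R.
  rewrite /lower -[A *+ n]mulr_natr (_ : n%:R = c%:R * q%:R + r%:R :> R); last first.
    by rewrite {1}n_eq natrD natrM.
  by rewrite /B /A /g; ring.
rewrite lowerE => -[le_sum eq_sum].
set s := \sum_(u : G) _%:R^-1 in leK trK le_sum eq_sum *.
(* [B] is negative, so the bound [s <= c] from Caro-Wei turns into a lower bound on [B * s]. *)
have leB : B * c%:R <= B * s by rewrite ler_nM2l //; lra.
split=> [|eqlow]; first by lra.
have B_neq0 : B != 0 by rewrite lt_eqF.
(* Equality makes both estimates tight: [s = c] squeezes [#|K|] to [s], the equality case of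
   Caro-Wei, and every [x u] is [q] or [q.+1]. *)
have eqs : s = c%:R by apply: (mulfI B_neq0); lra.
have /forallP eqx : [forall u, (x u == q) || (x u == q.+1)].
  by rewrite -eq_sum eqlow eqs.
split=> // u v w; apply: trK; rewrite ?inE //; lra.
Qed.

(** * The Turan graph *)

(** Non-adjacency is an equivalence relation with classes [part u]. Each class contributes 1 to the
    sum of inverses, so there are [c] classes; as their sizes are [q] or [q.+1] and add up to [n],
    exactly [r] are large. *)
Lemma balanced_multipartite_iso (R : realFieldType) (n c q r : nat)
    (G : sgraph) :
  n = (c * q + r)%N -> (r < c)%N -> #|G| = n ->
  (forall u v w : G, ~~ adj u v -> ~~ adj v w -> ~~ adj u w) ->
  (forall u : G, (#|non_neighbours [set: G] u| == q)
              || (#|non_neighbours [set: G] u| == q.+1)) ->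
  \sum_(u : G) #|non_neighbours [set: G] u|%:R^-1 = c%:R :> R ->
  graph_iso G (turan_graph n c).
Proof.
move=> n_eq lt_rc cardG trG sizes sumV.
pose part := non_neighbours [set: G].
have part_mem u v : (v \in part u) = ~~ adj u v by rewrite !inE.
have part_eq u v : (part u == part v) = ~~ adj u v.
  apply/eqP/idP => [eqp|nauv]; first by rewrite -part_mem eqp part_mem adj_irrefl.
  apply/setP => w; rewrite !part_mem; apply/idP/idP; last exact: trG.
  by apply: trG; rewrite adj_sym.
pose P := part @: [set: G].
have partP u : part u \in P by rewrite imset_f ?inE.
have sumP (V : nmodType) (F : {set G} -> V) :
    \sum_(u : G) F (part u) = \sum_(B in P) F B *+ #|B|.
  rewrite (eq_bigl (mem [set: G])) => [|u]; last by rewrite !inE.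
  rewrite (partition_big_imset part) /=; apply: eq_bigr => B /imsetP[u _ ->].
  rewrite (eq_bigr (fun=> F (part u))) => [|v /andP[_ /eqP-> //]].
  rewrite sumr_const; congr (_ *+ _); apply: eq_card => v.
  by rewrite [RHS]part_mem unfold_in /= inE part_eq adj_sym.
have P_gt0 B : B \in P -> (0 < #|B|)%N.
  by case/imsetP => u _ ->; apply: non_neighbours_gt0; rewrite inE.
have cardP : #|P| = c.
  apply/eqP; rewrite -(eqr_nat R) -sumV (sumP _ (fun B => #|B|%:R^-1)).
  rewrite (eq_bigr (fun=> 1)) ?sumr_const // => B /P_gt0 B_gt0.
  by rewrite -[LHS]mulr_natr mulVf // pnatr_eq0 -lt0n.
pose L := [set B in P | #|B| == q.+1].
have cardB B : B \in P -> #|B| = (q + (B \in L))%N.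
  move=> BP; rewrite inE BP; case/imsetP: BP => u _ -> /=.
  by case/orP: (sizes u); rewrite -/(part u) => /eqP ->; rewrite ?eqxx; lia.
have cardL : #|L| = r.
  have : n = (\sum_(B in P) #|B|)%N.
    rewrite -cardG -sum1_card; have /= -> := sumP nat (fun=> 1%N).
    by apply: eq_bigr => B _; rewrite -[LHS]/(_%:R) natn.
  rewrite (eq_bigr _ cardB) big_split /= sum_nat_const cardP -big_mkcondr /=.
  rewrite sum1_card n_eq => /addnI ->.
  by apply: eq_card => B; rewrite [RHS]unfold_in /= inE; case: (B \in P).
(* Large classes come first, because the residues below [r] are those taken [q.+1] times among the
   integers below [n]. *)
pose s := enum L ++ enum (P :\: L).
have memL B : B \in enum L = (B \in L) by rewrite mem_enum.
have sLP : L \subset P by apply/subsetP => B; rewrite inE => /andP[].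
have mem_s B : B \in P -> B \in s.
  by move=> BP; rewrite mem_cat !mem_enum in_setD BP andbT orbN.
have size_s : size s = c.
  by rewrite size_cat -!cardE cardsDS // subnKC ?subset_leq_card.
have idx_lt B : B \in P -> (index B s < c)%N.
  by move=> BP; rewrite -size_s index_mem mem_s.
have idxL B : B \in P -> (index B s < r)%N = (B \in L).
  move=> BP; rewrite index_cat memL; case: ifPn => BL.
    by rewrite -cardL cardE index_mem memL.
  by rewrite -cardL cardE ltnNge leq_addr.
(* The [i]-th vertex of the [k]-th class goes to [i * c + k], which has residue [k] modulo [c]. *)
pose f0 u := (index u (enum (part u)) * c + index (part u) s)%N.
have f0_lt u : (f0 u < n)%N.
  have := cardB _ (partP u); rewrite -(idxL _ (partP u)) => cardu.
  have : (index u (enum (part u)) < #|part u|)%N.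
    by rewrite cardE index_mem mem_enum part_mem adj_irrefl.
  rewrite cardu n_eq /f0; have := idx_lt _ (partP u).
  by move: (index u _) (index _ s) => i k; case: ltnP => /= kr lt_k lt_i;
    have := leq_mul lt_i (leqnn c); rewrite ?addn0 ?addn1 mulSn; lia.
have f0_mod u : (f0 u %% c = index (part u) s)%N.
  by rewrite modnMDl modn_small ?idx_lt.
have part_inj u v : (f0 u %% c == f0 v %% c)%N = (part u == part v).
  rewrite !f0_mod; apply/eqP/eqP => [|-> //].
  by apply: (index_inj set0); rewrite mem_s.
exists (fun u => Ordinal (f0_lt u) : turan_graph n c).
  apply: inj_card_bij; last by rewrite card_ord cardG.
  move=> u v /(congr1 val) /= eqf.
  have /eqP eqp : part u == part v by rewrite -part_inj eqf.
  move: eqf; rewrite /f0 eqp => /addIn /eqP; rewrite eqn_pmul2r; last lia.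
  by move/eqP; apply: (index_inj u); rewrite mem_enum part_mem -part_eq ?eqp eqxx.
by move=> u v; rewrite /= /turan_adj /= part_inj part_eq negbK.
Qed.

Lemma graph_iso_degree_sum (R : nmodType) (f : nat -> R) (G H : sgraph) :
  graph_iso G H -> \sum_(u : G) f (degree u) = \sum_(v : H) f (degree v).
Proof.
move=> [h h_bij h_adj]; rewrite (reindex h) /=; last exact: onW_bij.
apply: eq_bigr => u _; congr f; rewrite /degree.
rewrite -(card_imset _ (bij_inj h_bij)); apply: eq_card => v.
have [h' hK h'K] := h_bij; rewrite -[v]h'K inE h_adj.
by rewrite (mem_imset _ _ (bij_inj h_bij)) inE.
Qed.

Lemma turan_degree_sum (R : pzRingType) (f : nat -> R) (n c q r : nat) :
  (0 < c)%N -> n = (c * q + r)%N -> (r < c)%N ->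
  \sum_(u : turan_graph n c) f (degree u) =
    (c%:R - r%:R) * q%:R * f (n - q)%N + r%:R * q.+1%:R * f (n - q.+1)%N.
Proof.
move=> c_gt0 n_eq lt_rc.
have divE : (n %/ c = q)%N by rewrite n_eq mulnC divnMDl // divn_small ?addn0.
have modE : (n %% c = r)%N by rewrite n_eq mulnC modnMDl modn_small.
pose sz k := (q + (k < r))%N.
have cardp k : (k < c)%N -> #|turan_part n c k| = sz k.
  by move=> lt_kc; rewrite card_turan_part // divE modE.
have degE (i : turan_graph n c) : degree i = (n - sz (i %% c))%N.
  rewrite /degree cardsCs card_ord -cardp ?ltn_pmod //; congr (_ - _)%N.
  by apply: eq_card => j; rewrite !inE /= /turan_adj negbK eq_sym.
rewrite (partition_big (fun i : 'I_n => Ordinal (ltn_pmod i c_gt0)) predT) //=.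
rewrite (eq_bigr (fun k : 'I_c => f (n - sz k)%N *+ sz k)) => [|k _]; last first.
  rewrite (eq_bigr (fun=> f (n - sz k)%N)) => [|i /eqP <-]; last by rewrite degE.
  rewrite sumr_const -cardp //; congr (_ *+ _).
  by apply: eq_card => i; rewrite [RHS]inE.
rewrite -(big_mkord xpredT (fun k => f (n - sz k)%N *+ sz k)).
(* The residues are cut at [r], where the class size passes from [q.+1] to [q]. *)
rewrite (@big_cat_nat _ _ _ r) //=; last exact: ltnW.
rewrite (eq_big_nat _ _ (F2 := fun=> f (n - q.+1)%N *+ q.+1)) => [|k /andP[_ lt_kr]];
  last by rewrite /sz lt_kr addn1.
rewrite [X in _ + X](eq_big_nat _ _ (F2 := fun=> f (n - q)%N *+ q)) =>
  [|k /andP[le_rk _]]; last by rewrite /sz ltnNge le_rk addn0.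
rewrite !sumr_const_nat subn0 addrC -natrB 1?ltnW // -!natrM !mulr_natl.
by rewrite -!mulrnA ![(_ * (_ - _))%N]mulnC [(r * _)%N]mulnC.
Qed.

(** * The upper bound, by growing an induced subgraph *)

(** For [u] in [S], the cardinal is the degree of [u] in the subgraph induced by [S]. *)
Definition neighbours (G : sgraph) (S : {set G}) (u : G) : {set G} :=
  [set v in S | adj u v].

(** The pattern of [pineapple_adj] inside [S], with hub [w]. When [S = K], any vertex of [K] can be
    taken as [w]. *)
Definition pineapple_on (G : sgraph) (S K : {set G}) (w : G) : Prop :=
  [/\ K \subset S, w \in K & {in S &, forall u v, adj u v =
    (u != v) && [|| (u \in K) && (v \in K),
                    (u == w) && (v \notin K) | (v == w) && (u \notin K)]}].

Lemma clique_adj (G : sgraph) (K : {set G}) :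
  clique K -> {in K &, forall u v, adj u v = (u != v)}.
Proof.
move=> /forall_inP cK u v uK vK; have [->|nuv] := eqVneq u v.
  exact: adj_irrefl.
by move/forall_inP: (cK u uK) => /(_ v vK); rewrite nuv.
Qed.

(** If no edge left [S], then [S] would be closed under adjacency and contain the whole component of
    [x0]. *)
Lemma connected_boundary (G : sgraph) (S : {set G}) (x0 : G) :
  connected_graph G -> x0 \in S -> (#|S| < #|G|)%N ->
  exists x v, [/\ x \in S, v \notin S & adj x v].
Proof.
move=> [_ conn] x0S lt_SG.
have [/exists_inP[x xS /existsP[v /andP[vS axv]]]|none] :=
  boolP [exists x in S, [exists v, (v \notin S) && adj x v]].
  by exists x, v.
have step x v : x \in S -> adj x v -> v \in S.
  move=> xS axv; apply: contraNT none => vS.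
  by apply/exists_inP; exists x => //; apply/existsP; exists v; rewrite vS.
have clS : closed (@adj G) (mem S).
  by move=> x v axv; apply/idP/idP => /step; apply; rewrite // adj_sym.
suff SG : S = [set: G] by rewrite SG cardsT ltnn in lt_SG.
by apply/setP => v; rewrite inE -(closed_connect clS (conn x0 v)).
Qed.

Lemma convex_step (R : realDomainType) (f : nat -> R) (d e : nat) :
  (forall k, (0 < k)%N -> f k.+1 - f k.+2 < f k - f k.+1) ->
  (0 < d)%N -> (d <= e)%N ->
  f e - f e.+1 <= f d - f d.+1 ?= iff (d == e).
Proof.
move=> f_conv d_gt0; rewrite leq_eqVlt => /predU1P[->|lt_de].
  by rewrite eqxx; apply/leif_refl.
rewrite (ltn_eqF lt_de); apply/leifP.
(* [f] is convex on positive integers only; the shift makes the sequence start at 0. *)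
have := @convex_slope R (fun k => f k.+1) e d.-1 e.-1.
rewrite !prednK //; last by lia.
have h k : (k.+1 < e)%N -> f k.+2 - f k.+1 < f k.+3 - f k.+2.
  by move=> _; have := f_conv k.+1 isT; lra.
by move=> /(_ h) hd; have : f d.+1 - f d < f e.+1 - f e; [apply: hd; lia | lra].
Qed.

Lemma card_neighboursU1 (G : sgraph) (S : {set G}) (u v : G) :
  v \notin S -> #|neighbours (v |: S) u| = (#|neighbours S u| + adj u v)%N.
Proof.
move=> vS; case auv: (adj u v).
  rewrite addn1 -[RHS]add1n -(_ : v \notin neighbours S u = 1%N :> nat).
    rewrite -cardsU1; apply: eq_card => x; rewrite !inE.
    by have [->|_] := eqVneq x v.
  by rewrite inE (negbTE vS).
rewrite addn0; apply: eq_card => x; rewrite !inE.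
by have [->|_] := eqVneq x v; rewrite ?auv ?andbF.
Qed.

Lemma card_neighbours_lt (G : sgraph) (S : {set G}) (u : G) :
  u \in S -> (#|neighbours S u| < #|S|)%N.
Proof.
move=> uS; apply/proper_card/properP; split.
  by apply/subsetP => v; rewrite inE => /andP[].
by exists u; rewrite // inE adj_irrefl andbF.
Qed.

Lemma dominating_adj (G : sgraph) (S : {set G}) (u : G) :
  u \in S -> #|neighbours S u| = #|S|.-1 ->
  {in S, forall v, v != u -> adj u v}.
Proof.
move=> uS cardN v vS nvu.
have : neighbours S u == S :\ u.
  rewrite eqEcard cardN [#|S|](cardsD1 u) uS leqnn andbT.
  apply/subsetP => w; rewrite !inE => /andP[-> auw]; rewrite andbT.
  by apply: contraTneq auw => ->; rewrite adj_irrefl.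
by move/eqP/setP/(_ v); rewrite !inE nvu vS => /andP[].
Qed.

(* Either x is the hub w, or S is a clique and any of its vertices can serve
   as the hub. *)
Lemma pineapple_onU1 (G : sgraph) (S K : {set G}) (w x v : G) :
  pineapple_on S K w -> (1 < #|K|)%N -> x \in S -> v \notin S -> adj x v ->
  {in S, forall u, u != x -> ~~ adj u v} ->
  {in S, forall u, u != x -> adj x u} ->
  exists w', pineapple_on (v |: S) K w'.
Proof.
move=> [sKS wK adjE] K_gt1 xS vS axv nav ax.
have wS := subsetP sKS _ wK.
have vK : v \notin K by apply: contra vS => /(subsetP sKS).
have nxv : x != v by apply: contraNneq vS => <-.
(* Once [x] is a hub of [S], attaching the pendant vertex [v] to it keeps the pattern. *)
suff [xK xhub] : x \in K /\ {in S &, forall u u', adj u u' =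
    (u != u') && [|| (u \in K) && (u' \in K),
      (u == x) && (u' \notin K) | (u' == x) && (u \notin K)]}.
  have avE u : u \in S -> adj u v = (u == x).
    by move=> uS; have [->|/(nav _ uS)/negbTE] := eqVneq u x.
  have nv u : u \in S -> (u == v) = false.
    by move=> uS; apply: contraNF vS => /eqP <-.
  exists x; split=> [||u u']; rewrite ?xK //.
    by rewrite (subset_trans sKS) // subsetUr.
  rewrite !in_setU1 => /predU1P[->|uS] /predU1P[->|u'S].
  - by rewrite adj_irrefl eqxx.
  - rewrite adj_sym avE // (negbTE vK) [v == u']eq_sym nv //=.
    by rewrite [v == x]eq_sym (negbTE nxv) andbT.
  - by rewrite avE // (negbTE vK) nv //= andbF [v == x]eq_sym (negbTE nxv) andbT orbF.
  - exact: xhub.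
have [->|nxw] := eqVneq x w; first by split.
(* Outside [K] and distinct from [w], the vertex [x] would be adjacent to [w] alone, yet it
   dominates a second vertex of [K]. *)
have xK : x \in K.
  apply: contraT => xK.
  have /card_gt1P[a [b [aK bK nab]]] := K_gt1.
  have [y yK nyw] : exists2 y, y \in K & y != w.
    by have [<-|] := eqVneq a w; [exists b; rewrite // eq_sym | exists a].
  have yS := subsetP sKS _ yK.
  have nyx : y != x by apply: contraNneq xK => <-.
  have := ax y yS nyx.
  by rewrite adjE // (negbTE xK) (negbTE nxw) (negbTE nyw) andbF.
(* A vertex outside [K] is adjacent to [w] alone, hence not to [x]; so [S] lies in [K]. *)
have SK u : u \in S -> u \in K.
  move=> uS; apply: contraT => uK.
  have nux : u != x by apply: contraNneq uK => ->.
  have nuw : u != w by apply: contraNneq uK => ->.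
  have := ax u uS nux.
  by rewrite adjE // (negbTE uK) (negbTE nxw) (negbTE nuw) !andbF.
by split=> // u u' uS u'S; rewrite adjE // !SK //= !andbF.
Qed.

(** Induction on [s - c]. The positivity clause keeps the degrees in the range where [f] is
    decreasing and convex at the next step. *)
Lemma degree_sum_upper_on (R : realFieldType) (f : nat -> R) (c s : nat)
    (G : sgraph) (K0 : {set G}) :
  (forall d e, (0 < d)%N -> (d < e)%N -> f e < f d) ->
  (forall d, (0 < d)%N -> f d.+1 - f d.+2 < f d - f d.+1) ->
  (1 < c)%N -> connected_graph G -> clique K0 -> #|K0| = c ->
  (c <= s)%N -> (s <= #|G|)%N ->
  let upper := (s%:R - c%:R) * f 1%N + f s.-1 + (c%:R - 1) * f c.-1 in
  exists S : {set G}, [/\ #|S| = s,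
    {in S, forall u, (0 < #|neighbours S u|)%N},
    \sum_(u in S) f #|neighbours S u| <= upper &
    \sum_(u in S) f #|neighbours S u| = upper ->
      exists2 K : {set G}, #|K| = c & exists w, pineapple_on S K w].
Proof.
move=> f_decr f_conv c_gt1 conn cK0 cardK0 le_cs.
have c_gt0 : (0 < c)%N by apply: ltnW.
rewrite -(subnKC le_cs); move: (s - c)%N => {le_cs}k.
elim: k => [|k IHk] le_sG /=.
  rewrite addn0 in le_sG *; exists K0.
  have cardN u : u \in K0 -> #|neighbours K0 u| = c.-1.
    move=> uK; rewrite -cardK0 [in RHS](cardsD1 u) uK; apply: eq_card => v.
    rewrite !inE; case vK: (v \in K0); rewrite ?andbF //= andbT.
    by rewrite (clique_adj cK0) // eq_sym.
  have sumE : \sum_(u in K0) f #|neighbours K0 u| =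
      (c%:R - c%:R) * f 1%N + f c.-1 + (c%:R - 1) * f c.-1.
    rewrite (eq_bigr (fun=> f c.-1)) => [|u uK]; last by rewrite cardN.
    by rewrite sumr_const cardK0 -[LHS]mulr_natr; ring.
  split=> // [u uK||_]; first by rewrite cardN // -subn1 subn_gt0.
    by rewrite sumE.
  have [w wK] : exists w, w \in K0 by apply/card_gt0P; rewrite cardK0.
  exists K0 => //; exists w; split=> // u v uK vK.
  by rewrite (clique_adj cK0) // uK vK /= andbT.
have [|S [cardS degS leS eqS]] := IHk; first by lia.
have [x0 x0S] : exists x, x \in S by apply/card_gt0P; rewrite cardS; lia.
have [|x [v [xS vS axv]]] := connected_boundary conn x0S; first by lia.
set t := (c + k)%N in cardS leS eqS.
have t_gt0 : (0 < t)%N by rewrite /t; lia.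
have tE : (c + k.+1 = t.+1)%N by rewrite addnS.
(* The degree of [x] in [S] is at most [t.-1], and the drops of [f] decrease, so the smallest
   possible drop occurs when [x] dominates [S]. *)
have hub_gain : f #|neighbours S x|.+1 <= f #|neighbours S x| - (f t.-1 - f t)
    ?= iff (#|neighbours S x| == t.-1).
  have : (#|neighbours S x| <= t.-1)%N.
    by have := card_neighbours_lt xS; rewrite cardS; lia.
  move=> /(convex_step f_conv (degS _ xS)); rewrite prednK // => -[le_d eq_d].
  by split; [lra | rewrite -eq_d; apply/eqP/eqP; lra].
(* Other degrees can only grow; equality means that [v] is adjacent to none of these vertices. *)
have others : \sum_(u in S | u != x) f #|neighbours (v |: S) u| <=
    \sum_(u in S | u != x) f #|neighbours S u|
    ?= iff [forall (u | (u \in S) && (u != x)), ~~ adj u v].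
  apply: leif_sum => u /andP[uS _]; rewrite card_neighboursU1 //.
  case: (adj u v); rewrite ?addn0 ?addn1 /=; last exact/leif_refl.
  by apply/leifP; rewrite f_decr ?degS.
have new_gt0 : (0 < #|neighbours (v |: S) v|)%N.
  by apply/card_gt0P; exists x; rewrite !inE xS orbT adj_sym.
have new : f #|neighbours (v |: S) v| <= f 1%N.
  move: new_gt0; rewrite leq_eqVlt => /predU1P[<- //|h].
  by apply/ltW/f_decr.
exists (v |: S); rewrite tE; rewrite cardsU1 vS cardS add1n.
have sumE : \sum_(u in v |: S) f #|neighbours (v |: S) u| =
    f #|neighbours (v |: S) v| + (f #|neighbours S x|.+1 +
    \sum_(u in S | u != x) f #|neighbours (v |: S) u|).
  rewrite big_setU1 //= (bigD1 x) //=.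
  by rewrite [in X in _ + (X + _)]card_neighboursU1 // axv addn1.
have sumSE : \sum_(u in S) f #|neighbours S u| = f #|neighbours S x| +
    \sum_(u in S | u != x) f #|neighbours S u| by rewrite (bigD1 x).
have [le_hub eq_hub] := hub_gain; have [le_oth eq_oth] := others.
(* From [t] to [t.+1] the bound grows by [f 1 - (f t.-1 - f t)], the total of the three
   estimates. *)
rewrite sumE; move: leS eqS; rewrite sumSE -[t.+1%:R]natr1 /= => leS eqS.
split=> //.
- move=> u; rewrite in_setU1 => /predU1P[-> //|uS].
  by rewrite card_neighboursU1 // ltn_addr // degS.
- lra.
move=> eqU.
have [K cardK [w pinK]] := eqS ltac:(lra).
have /eqP domx : #|neighbours S x| == t.-1 by rewrite -eq_hub; apply/eqP; lra.
have /forall_inP nav : [forall (u | (u \in S) && (u != x)), ~~ adj u v].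
  by rewrite -eq_oth; apply/eqP; lra.
exists K => //; apply: (pineapple_onU1 pinK) axv _ _ => //; first by rewrite cardK.
  by move=> u uS nux; apply: nav; rewrite uS.
by apply: dominating_adj; rewrite // cardS.
Qed.

Lemma degree_sum_upper (R : realFieldType) (f : nat -> R) (n c : nat)
    (G : sgraph) :
  (forall d e, (0 < d)%N -> (d < e)%N -> f e < f d) ->
  (forall d, (0 < d)%N -> f d.+1 - f d.+2 < f d - f d.+1) ->
  (1 < c)%N -> connected_graph G -> #|G| = n -> clique_number G = c ->
  let upper := (n%:R - c%:R) * f 1%N + f n.-1 + (c%:R - 1) * f c.-1 in
  \sum_(u : G) f (degree u) <= upper /\
  (\sum_(u : G) f (degree u) = upper ->
    exists2 K : {set G}, #|K| = c & exists w, pineapple_on [set: G] K w).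
Proof.
move=> f_decr f_conv c_gt1 conn cardG cl /=.
have [K0 cK0 cardK0] : exists2 K : {set G}, clique K & #|K| = c.
  have cl0 : clique (set0 : {set G}) by apply/forall_inP => u; rewrite inE.
  have cl_gt0 : (0 < #|[pred K : {set G} | clique K]|)%N.
    by apply/card_gt0P; exists set0.
  have [K cK eK] := eq_bigmax_cond (fun K : {set G} => #|K|) cl_gt0.
  by exists K; rewrite // -cl -eK.
have le_cn : (c <= n)%N by rewrite -cardK0 -cardG max_card.
have le_nG : (n <= #|G|)%N by rewrite cardG.
have [S [cardS _ leS eqS]] :=
  degree_sum_upper_on f_decr f_conv c_gt1 conn cK0 cardK0 le_cn le_nG.
have ST : S = [set: G] by apply/eqP; rewrite eqEcard subsetT cardsT cardG cardS /=.
have sumE : \sum_(u in S) f #|neighbours S u| = \sum_(u : G) f (degree u).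
  rewrite ST; apply: eq_big => u; rewrite ?inE // => _; congr f.
  by apply: eq_card => v; rewrite !inE.
by rewrite -sumE; split=> // /eqS; rewrite ST.
Qed.

(** * The pineapple graph *)

Lemma pineapple_on_iso (n c : nat) (G : sgraph) (K : {set G}) (w : G) :
  #|G| = n -> #|K| = c -> pineapple_on [set: G] K w ->
  graph_iso G (pineapple_graph n c).
Proof.
move=> cardG cardK [_ wK adjE].
(* Hub first, then the rest of [K], then the pendant vertices: index 0 marks [w] and indices below
   [c] mark [K]. *)
pose s := w :: enum (K :\ w) ++ enum (~: K).
have mem_s u : u \in s.
  rewrite inE mem_cat !mem_enum !inE.
  by case: (u \in K); rewrite ?andbT ?orbT //= orbF orbN.
have c_eq : c = (size (enum (K :\ w))).+1.
  by rewrite -cardE -cardK (cardsD1 w K) wK.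
have size_s : size s = n.
  by rewrite /= size_cat -addSn -c_eq -cardE -cardG -cardK cardsC.
have idx_lt u : (index u s < n)%N by rewrite -size_s index_mem.
have idx0 u : (index u s == 0)%N = (u == w).
  by rewrite /s /= [w == u]eq_sym; case: (u == w).
have idxK u : (index u s < c)%N = (u \in K).
  rewrite c_eq /s /= [w == u]eq_sym; have [->|nuw] := eqVneq u w; first by rewrite wK.
  rewrite ltnS index_cat mem_enum !inE nuw /=; case: ifPn => uK.
    by rewrite index_mem mem_enum !inE nuw.
  by rewrite ltnNge leq_addr.
have idx_inj u v : (index u s == index v s) = (u == v).
  by apply/eqP/eqP => [|-> //]; apply: (index_inj u); rewrite mem_s.
exists (fun u => Ordinal (idx_lt u) : pineapple_graph n c).
  apply: inj_card_bij; last by rewrite card_ord cardG.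
  by move=> u v /(congr1 val) /eqP; rewrite /= idx_inj => /eqP.
move=> u v; rewrite adjE ?inE //= /pineapple_adj -val_eqE.
by rewrite idx_inj !idx0 ![(c <= _)%N]leqNgt !idxK.
Qed.

Lemma pineapple_degree (n c : nat) (i : pineapple_graph n c) :
  (0 < c)%N -> (c <= n)%N ->
  degree i = if i == 0%N :> nat then n.-1 else if (i < c)%N then c.-1 else 1%N.
Proof.
move=> c_gt0 le_cn; have n_gt0 := leq_trans c_gt0 le_cn; rewrite /degree.
have [i0|ni0] := eqVneq (i : nat) 0%N.
  have -> : n.-1 = #|[set~ i]| by rewrite cardsC1 card_ord.
  apply: eq_card => j; rewrite !inE /= /pineapple_adj i0 eq_sym /= c_gt0 /=.
  by case: ltnP; rewrite /= andbT.
case: ltnP => lt_ic.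
  have cardc : #|[set j : 'I_n | (j < c)%N]| = c.
    by rewrite -sum1dep_card -(big_ord_widen n (fun=> 1%N)) // sum1_card card_ord.
  have -> : c.-1 = #|[set j : 'I_n | (j < c)%N] :\ i|.
    by rewrite -[in LHS]cardc (cardsD1 i) inE lt_ic.
  apply: eq_card => j.
  rewrite !inE /= /pineapple_adj lt_ic eq_sym /= (negbTE ni0) [(c <= i)%N]leqNgt lt_ic.
  by rewrite andbF !orbF.
rewrite -(cards1 (Ordinal n_gt0)); apply: eq_card => j.
rewrite !inE /= /pineapple_adj -!val_eqE /=.
lia.
Qed.

Lemma pineapple_degree_sum (R : pzRingType) (f : nat -> R) (n c : nat) :
  (0 < c)%N -> (c <= n)%N ->
  \sum_(u : pineapple_graph n c) f (degree u) =
    (n%:R - c%:R) * f 1%N + f n.-1 + (c%:R - 1) * f c.-1.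
Proof.
move=> c_gt0 le_cn; have n_gt0 := leq_trans c_gt0 le_cn.
pose F i := f (if i == 0%N then n.-1 else if (i < c)%N then c.-1 else 1%N).
rewrite (eq_bigr (fun i : 'I_n => F i)) => [|i _]; last by rewrite pineapple_degree.
rewrite -(big_mkord xpredT F) (@big_cat_nat _ _ _ c) //= big_ltn // {1}/F /=.
rewrite (eq_big_nat _ _ (F2 := fun=> f c.-1)) => [|k /andP[k_gt0 lt_kc]];
  last by rewrite /F lt_kc gtn_eqF.
rewrite [X in _ + X](eq_big_nat _ _ (F2 := fun=> f 1%N)) => [|k /andP[le_ck _]];
  last by rewrite /F ltnNge le_ck gtn_eqF // (leq_trans c_gt0).
by rewrite !sumr_const_nat -natrB // -[1]/(1%:R) -natrB // !mulr_natl addrC addrA.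
Qed.

(** * Floor, ceiling and the conclusion *)

Lemma floor_nat_div (R : archiRealFieldType) (n c q r : nat) :
  (r < c)%N -> n = (c * q + r)%N -> Num.floor (n%:R / c%:R : R) = q.
Proof.
move=> lt_rc n_eq; have c_gt0 : 0 < c%:R :> R by rewrite ltr0n; lia.
apply: floor_def; rewrite intrD -!pmulrn.
by rewrite ler_pdivlMr // ltr_pdivrMr // natr1 -!natrM ler_nat ltr_nat; lia.
Qed.

Lemma ceil_nat_div (R : archiRealFieldType) (n c q r : nat) :
  (0 < r)%N -> (r < c)%N -> n = (c * q + r)%N ->
  Num.ceil (n%:R / c%:R : R) = q.+1.
Proof.
move=> r_gt0 lt_rc n_eq; have c_gt0 : 0 < c%:R :> R by rewrite ltr0n; lia.
apply: ceil_def; rewrite (_ : q.+1%:Z - 1 = q%:Z) -?pmulrn; last by lia.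
by rewrite ltr_pdivlMr // ler_pdivrMr // -!natrM ler_nat ltr_nat; lia.
Qed.

Theorem theorem3p4 (R : realType) (n c q r : nat) (gamma : R)
  (c_gt1 : (1 < c)%N) (c_lt_n : (c < n)%N)
  (n_eq : n = (c * q + r)%N) (r_lt_c : (r < c)%N)
  (gamma_le : gamma <= -1)
  (G : sgraph) (G_conn : connected_graph G)
  (G_order : #|G| = n) (G_clique : clique_number G = c) :
  let fl : R := (Num.floor (n%:R / c%:R : R))%:~R in
  let ce : R := (Num.ceil (n%:R / c%:R : R))%:~R in
  let lower : R :=
    (c%:R - r%:R) * fl * (n%:R - fl) `^ gamma
    + r%:R * ce * (n%:R - ce) `^ gamma in
  let upper : R :=
    n%:R - c%:R + (n%:R - 1) `^ gamma + (c%:R - 1) * (c%:R - 1) `^ gamma in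
  [/\ lower <= zeroth_order_randic gamma G <= upper,
      zeroth_order_randic gamma G = lower <-> graph_iso G (turan_graph n c)
    & zeroth_order_randic gamma G = upper <-> graph_iso G (pineapple_graph n c)].
Proof.
move=> fl ce lower upper.
have gamma_lt0 : gamma < 0 by lra.
pose f (d : nat) : R := d%:R `^ gamma.
have f_decr d e : (0 < d)%N -> (d < e)%N -> f e < f d.
  exact: powR_nat_decr.
have f_conv d : (0 < d)%N -> f d.+1 - f d.+2 < f d - f d.+1.
  exact: powR_nat_convex.
have c_gt0 : (0 < c)%N by apply: ltnW.
have le_cn := ltnW c_lt_n.
have flE : fl = q%:R.
  by rewrite /fl (floor_nat_div _ r_lt_c n_eq).
have upperE : upper = (n%:R - c%:R) * f 1%N + f n.-1 + (c%:R - 1) * f c.-1.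
  rewrite /upper /f powR1 mulr1 -!subn1 !natrB //.
  exact: leq_trans c_gt0 le_cn.
have lowerE : lower =
    (c%:R - r%:R) * q%:R * f (n - q)%N + r%:R * q.+1%:R * f (n - q.+1)%N.
  rewrite /lower flE /f natrB; last by nia.
  (* For [r = 0] the ceiling is [q] instead of [q.+1], but the factor [r] cancels the term on both
     sides. *)
  congr (_ + _); have [->|r_gt0] := posnP r; first by rewrite !mul0r.
  rewrite natrB; last by nia.
  by rewrite /ce (ceil_nat_div _ r_gt0 r_lt_c n_eq).
have [le_low eq_low] := degree_sum_lower f_decr f_conv c_gt1 c_lt_n n_eq r_lt_c
  G_conn G_order (eq_leq G_clique).
have [le_up eq_up] :=
  degree_sum_upper f_decr f_conv c_gt1 G_conn G_order G_clique.
rewrite upperE lowerE /zeroth_order_randic; split.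
- by rewrite le_low le_up.
- split=> [/eq_low[trG sizes sumV]|iso].
    exact: (balanced_multipartite_iso n_eq r_lt_c G_order trG sizes sumV).
  by rewrite (graph_iso_degree_sum f iso); apply: turan_degree_sum.
- split=> [/eq_up[K cardK [w pinK]]|iso]; first exact: pineapple_on_iso pinK.
  by rewrite (graph_iso_degree_sum f iso); apply: pineapple_degree_sum.
Qed.
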